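(* Suppose the limit $A:=\lim_{j\to\infty}\frac{a_j}{\log j}$ exists in $[0,\infty]$. If $\lambda\in(0,1]$ and $A>\frac{1}{\lambda\log\omega^{-1}}$, then integration in $\mathcal{H}_{d,\boldsymbol{a},\boldsymbol{b}}$ is ALG-strongly polynomially tractable with $\varepsilon$-exponent $2\lambda$, i.e. there is a constant $C>0$ such that $N(\varepsilon,d)\le C\varepsilon^{-2\lambda}$ for all $\varepsilon\in(0,1)$ and $d\in\mathbb{N}$. Consequently, if $A>\frac{1}{\log\omega^{-1}}$, then the optimal $\varepsilon$-exponent of ALG-strong polynomial tractability is at most $\frac{2}{A\log\omega^{-1}}$ (interpreted as $0$ if $A=\infty$).
   Context: $\mathbb{N}=\{1,2,\dots\}$. Let $\boldsymbol{a}=(a_j)_{j\ge1}$, $\boldsymbol{b}=(b_j)_{j\ge1}$ be sequences of positive reals with $0<a_1\le a_2\le\dots$ and $b_\ast=\inf_j b_j>0$. Fix $\omega\in(0,1)$. For $d\in\mathbb{N}$, $\mathcal{H}_{d,\boldsymbol{a},\boldsymbol{b}}$ is the reproducing kernel Hilbert space on $[0,1]^d$ with kernel $$K_{d,\boldsymbol{a},\boldsymbol{b}}(\boldsymbol{x},\boldsymbol{y})=\sum_{\boldsymbol{h}\in\mathbb{Z}^d}\omega^{\sum_{j=1}^d a_j|h_j|^{b_j}}\exp(2\pi \mathrm{i}\,\boldsymbol{h}\cdot(\boldsymbol{x}-\boldsymbol{y})).$$ Equivalently, it consists of the functions $f(\boldsymbol{x})=\sum_{\boldsymbol{h}\in\mathbb{Z}^d}\widehat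 f(\boldsymbol{h})\exp(2\pi\mathrm{i}\,\boldsymbol{h}\cdot\boldsymbol{x})$ with finite norm $\|f\|_{d,\boldsymbol{a},\boldsymbol{b}}=\big(\sum_{\boldsymbol{h}\in\mathbb{Z}^d}\omega^{-\sum_{j=1}^d a_j|h_j|^{b_j}}|\widehat f(\boldsymbol{h})|^2\big)^{1/2}$, where $\widehat f(\boldsymbol{h})=\int_{[0,1]^d} f(\boldsymbol{x})\exp(-2\pi\mathrm{i}\,\boldsymbol{h}\cdot\boldsymbol{x})\,d\boldsymbol{x}$. For a point set $\mathcal{P}=\{\boldsymbol{x}_0,\dots,\boldsymbol{x}_{N-1}\}\subset[0,1)^d$ and coefficients $\boldsymbol{w}=(w_0,\dots,w_{N-1})\in\mathbb{C}^N$, the worst-case integration error is $$e(\mathcal{H}_{d,\boldsymbol{a},\boldsymbol{b}},\mathcal{P},\boldsymbol{w})=\sup_{\|f\|_{d,\boldsymbol{a},\boldsymbol{b}}\le1}\Big|\int_{[0,1]^d}f(\boldsymbol{x})\,d\boldsymbol{x}-\sum_{k=0}^{N-1}w_kf(\boldsymbol{x}_k)\Big|.$$ The $N$th minimal worst-case error is $e(N,d)=\inf_{\mathcal{P},\boldsymbol{w}}e(\mathcal{H}_{d,\boldsymbol{a},\boldsymbol{b}},\mathcal{P},\boldsymbol{w})$ (over all such $\mathcal{P}$, $\boldsymbol{w}$ with $N$ points); the initial error is $e(0,d)=1$. The information complexity is $N(\varepsilon,d)=\min\{N\in\mathbb{N}: e(N,d)\le\varepsilon\}$ for $\varepsilon\in(0,1)$.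 ALG-strong polynomial tractability means that there exist $C>0$ and $p\ge0$ such that $N(\varepsilon,d)\le C\varepsilon^{-p}$ for all $\varepsilon\in(0,1)$, $d\in\mathbb{N}$; such a $p$ is called an $\varepsilon$-exponent, and the optimal $\varepsilon$-exponent is the infimum of all such $p$. *)

(* Defs.v *)
From HB Require Import structures.
From mathcomp Require Import all_boot all_order all_algebra finmap.
From mathcomp Require Import all_classical all_reals all_analysis.
From mathcomp Require Import complex.

Set Implicit Arguments.
Unset Strict Implicit.
Unset Printing Implicit Defensive.
Import Order.TTheory GRing.Theory Num.Theory.
Import numFieldNormedType.Exports.

Local Open Scope classical_set_scope.
Local Open Scope ring_scope.
Local Open Scope complex_scope.

(* Points of R^d.  On this type the library puts the product sigma-algebra, but
   it has no product measure; d-dimensional Lebesgue measure is built below. *)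
Notation pt R d := (d.-tuple (measurableTypeR R)).

Definition pt_cons (R : realType) (d : nat)
    (p : measurableTypeR R * pt R d) : pt R d.+1 :=
  [the d.+1.-tuple (measurableTypeR R) of p.1 :: p.2].

Lemma measurable_pt_cons (R : realType) (d : nat) :
  measurable_fun setT (@pt_cons R d).
Proof. by apply: measurable_cons. Qed.

Section lebesgue_cons.
Variables (R : realType) (d : nat).
Variable mu : {sigma_finite_measure set (pt R d) -> \bar R}.

Definition lebesgue_cons : set (pt R d.+1) -> \bar R :=
  pushforward (@lebesgue_measure R \x mu)%E (@pt_cons R d).

HB.instance Definition _ := Measure.copy lebesgue_cons
  (measure_function_pushforward__canonical__measure_function_Measure
     (@lebesgue_measure R \x mu)%E (@measurable_pt_cons R d)).

Lemma sigma_finite_lebesgue_cons : sigma_finite setT lebesgue_cons.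
Proof.
have /sigma_finiteP[F [FT Fnd Foo]] := sigma_finiteT (@lebesgue_measure R).
have /sigma_finiteP[G [GT Gnd Goo]] := sigma_finiteT mu.
pose g (t : pt R d.+1) : measurableTypeR R * pt R d :=
  (thead t, [tuple of behead t]).
have mg : measurable_fun setT g.
  apply/measurable_fun_pairP; split.
    exact: measurable_tnth.
  exact: measurable_behead.
have gK p : g (pt_cons p) = p.
  by case: p => x t; rewrite /g /pt_cons /=; congr (_, _); apply/val_inj.
exists (fun n => g @^-1` (F n `*` G n)).
  apply/esym; rewrite -subTset => t _.
  have : setT (g t).1 by [].
  rewrite [X in X _]FT => -[n _ Fn].
  have : setT (g t).2 by [].
  rewrite [X in X _]GT => -[k _ Gk].
  exists (maxn n k) => //; split.
    by move: (_.1) Fn; exact/subsetPset/Fnd/leq_maxl.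
  by move: (_.2) Gk; exact/subsetPset/Gnd/leq_maxr.
move=> n; have [mF Fn] := Foo n; have [mG Gn] := Goo n; split.
  by rewrite -[X in measurable X]setTI; apply: mg => //; exact: measurableX.
rewrite /lebesgue_cons /pushforward -comp_preimage.
rewrite (_ : g \o @pt_cons R d = id) ?preimage_id; last exact/funext.
by rewrite product_measure1E// lte_mul_pinfty// ge0_fin_numE.
Qed.

HB.instance Definition _ := Measure_isSigmaFinite.Build _ _ _ lebesgue_cons
  sigma_finite_lebesgue_cons.
End lebesgue_cons.

Fixpoint lebesgue_pt (R : realType) (d : nat) :
    {sigma_finite_measure set (pt R d) -> \bar R} :=
  if d is d'.+1 then lebesgue_cons (lebesgue_pt R d')
  else \d_ [tuple].

Definition cube (R : realType) (d : nat) : set (pt R d) :=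
  [set x | forall i, tnth x i \in `[0, 1]].

Definition half_open_cube (R : realType) (d : nat) : set (pt R d) :=
  [set x | forall i, tnth x i \in `[0, 1[].

Definition cube_integrable (R : realType) (d : nat) (f : pt R d -> R[i]) :=
  (lebesgue_pt R d).-integrable (@cube R d) (fun x => (complex.Re (f x))%:E) /\
  (lebesgue_pt R d).-integrable (@cube R d) (fun x => (complex.Im (f x))%:E).

Definition cube_integral (R : realType) (d : nat) (f : pt R d -> R[i]) : R[i] :=
  (\int[lebesgue_pt R d]_(x in @cube R d) complex.Re (f x)) +i*
  (\int[lebesgue_pt R d]_(x in @cube R d) complex.Im (f x)).

Definition cabs (R : realType) (z : R[i]) : R := ComplexField.Normc.normc z.

Definition expi (R : realType) (t : R) : R[i] := cos t +i* sin t.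

Definition dotZ (R : realType) (d : nat) (h : d.-tuple int) (x : pt R d) : R :=
  \sum_(i < d) (tnth h i)%:~R * tnth x i.

Definition fourier_coef (R : realType) (d : nat) (f : pt R d -> R[i])
    (h : d.-tuple int) : R[i] :=
  cube_integral (fun x => f x * expi (- (2 * pi * dotZ h x))).

(* Unordered summation: the sums over the finite subsets of I converge to s
   along the directed set of finite subsets. *)
Definition has_csum (R : realType) (I : choiceType) (u : I -> R[i])
    (s : R[i]) : Prop :=
  forall e : R, 0 < e -> exists A : {fset I}, forall B : {fset I},
    (A `<=` B)%fset -> cabs (\sum_(i <- B) u i - s) < e.

(* Sequences are indexed from 1: a 0 and b 0 are never used, and the i-th
   coordinate, i : 'I_d, carries the parameters a i.+1 and b i.+1. *)
Definition weight_exponent (R : realType) (a b : nat -> R) (d : nat)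
    (h : d.-tuple int) : R :=
  \sum_(i < d) a i.+1 * `|(tnth h i)%:~R| `^ b i.+1.

Definition Hnorm (R : realType) (a b : nat -> R) (omega : R) (d : nat)
    (f : pt R d -> R[i]) : \bar R :=
  sqrte (\esum_(h in [set: d.-tuple int])
    (omega `^ (- weight_exponent a b h) * cabs (fourier_coef f h) ^+ 2)%:E)%E.

(* The elements of the space are functions on the cube; values of f outside the
   cube are irrelevant to every notion below. *)
Definition in_H (R : realType) (a b : nat -> R) (omega : R) (d : nat)
    (f : pt R d -> R[i]) : Prop :=
  [/\ cube_integrable f,
      forall x, cube x ->
        has_csum (fun h => fourier_coef f h * expi (2 * pi * dotZ h x)) (f x)
    & (Hnorm a b omega f < +oo)%E].

Definition worst_case_error (R : realType) (a b : nat -> R) (omega : R)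
    (d N : nat) (x : 'I_N -> pt R d) (w : 'I_N -> R[i]) : \bar R :=
  ereal_sup [set (cabs (cube_integral f - \sum_(k < N) w k * f (x k)))%:E |
    f in [set f | in_H a b omega f /\ (Hnorm a b omega f <= 1)%E]].

Definition minimal_error (R : realType) (a b : nat -> R) (omega : R)
    (N d : nat) : \bar R :=
  ereal_inf [set e | exists (x : 'I_N -> pt R d) (w : 'I_N -> R[i]),
    [/\ injective x, forall k, half_open_cube (x k)
      & e = worst_case_error a b omega x w]].

(* Infimum of a set of positive integers, hence its minimum if the set is
   nonempty, and +oo otherwise. *)
Definition information_complexity (R : realType) (a b : nat -> R) (omega : R)
    (eps : R) (d : nat) : \bar R :=
  ereal_inf [set N%:R%:E | N in
    [set N | (1 <= N)%N /\ (minimal_error a b omega N d <= eps%:E)%E]].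

Definition ALG_SPT_exponent (R : realType) (a b : nat -> R) (omega : R)
    (p : R) : Prop :=
  0 <= p /\ exists2 C : R, 0 < C &
    forall (eps : R) (d : nat), 0 < eps < 1 -> (1 <= d)%N ->
      (information_complexity a b omega eps d <= (C * eps `^ (- p))%:E)%E.

(* The infimum is +oo when there is no eps-exponent at all. *)
Definition optimal_ALG_SPT_exponent (R : realType) (a b : nat -> R) (omega : R)
    : \bar R :=
  ereal_inf [set p%:E | p in ALG_SPT_exponent a b omega].

(* Main.v *)
Require Import Defs.
From mathcomp Require Import all_boot all_order all_algebra.
From mathcomp Require Import all_classical all_reals all_analysis.
From mathcomp Require Import complex finmap ring lra zify.
Set Implicit Arguments.
Unset Strict Implicit.
Unset Printing Implicit Defensive.
Import Order.TTheory GRing.Theory Num.Theory.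
Import numFieldNormedType.Exports.
Local Open Scope classical_set_scope.
Local Open Scope ring_scope.

(** The upper bound is achieved by rank-one lattice rules with N points, equal
    weights and N arbitrary.  For the points [{k z / N}] the error of f is the
    sum of [fhat h] over the nonzero h in the dual lattice [N | h.z], so its
    square is at most the sum of [r h = omega ^ (weight h)] over these h.  By
    Jensen's inequality it suffices to bound the sum of [r h ^ lambda] by
    [eps ^ (2 lambda)], and this is done on average over z.  For h with a
    nonzero coordinate [h_j], at most a proportion [|h_j| / N] of the z satisfies
    [N | h.z] whether or not N is prime; replacing [|h_j|] by the product of
    all [max 1 |h_j|] turns the average into [1 / N] times a product over the
    coordinates.  This product is bounded uniformly in d because the weights
    decay faster than any power in each coordinate, and
    [omega ^ (lambda a_j)] is summable when [A lambda ln omega^-1 > 1]. *)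

(** * Bounded partial sums of one-variable series *)

Lemma powR_expR (R : realType) (x y : R) : 0 < x -> x `^ y = expR (y * ln x).
Proof. by move=> x0; rewrite /powR gt_eqF. Qed.

(* Since ln (j / (j-1)) >= 1/j, the term j^-(t+1) is at most
   ((j-1)^-t - j^-t) / t, and the series telescopes. *)
Lemma sum_powRN_bounded (R : realType) (s : R) : 1 < s ->
  exists2 M : R, 0 <= M &
    forall n, \sum_(1 <= k < n) k%:R `^ (- s) <= M.
Proof.
move=> s1; pose t := s - 1; have t0 : 0 < t by rewrite subr_gt0.
exists (1 + t^-1); first by rewrite addr_ge0// invr_ge0 ltW.
have step k : (0 < k)%N ->
    k.+1%:R `^ (- s) <= t^-1 * (k%:R `^ (- t) - k.+1%:R `^ (- t)).
  move=> k0; have kR : 0 < k%:R :> R by rewrite ltr0n.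
  have kS : 0 < k.+1%:R :> R by rewrite ltr0n.
  have lnk : k.+1%:R^-1 <= ln k.+1%:R - ln k%:R :> R.
    rewrite -ln_div ?posrE// -[_ / _]invrK lnV ?posrE ?invr_gt0 ?divr_gt0//.
    rewrite invf_div lerNr.
    rewrite [X in ln X](_ : _ = 1 + - k.+1%:R^-1); last first.
      apply: (mulIf (lt0r_neq0 kS)).
        rewrite mulfVK ?gt_eqF// mulrDl mul1r mulNr mulVf ?gt_eqF//.
        by rewrite -natr1 addrK.
    rewrite le_ln1Dx//.
    by rewrite ltrN2 invf_lt1 ?ltr0n// ltr1n.
  have es : k.+1%:R `^ (- s) = k.+1%:R^-1 * k.+1%:R `^ (- t).
    rewrite -[X in X * _]powR_inv1 ?ltW// -powRD ?(gt_eqF kS) ?implybT//.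
    by congr (_ `^ _); rewrite /t; lra.
  have et : k.+1%:R `^ (- t) * (1 + t / k.+1%:R) <= k%:R `^ (- t).
    rewrite !powR_expR//.
    rewrite [- t * ln k%:R](_ : _ =
      - t * ln k.+1%:R + t * (ln k.+1%:R - ln k%:R)); last by ring.
    rewrite expRD ler_pM2l ?expR_gt0//.
    apply: le_trans (expR_ge1Dx _); rewrite lerD2l ler_pM2l//.
  rewrite es ler_pdivlMl// lerBrDr.
  by apply: le_trans et; rewrite le_eqVlt; apply/orP; left; apply/eqP; ring.
have main n : (0 < n)%N ->
    \sum_(1 <= k < n.+1) k%:R `^ (- s) <= 1 + t^-1 * (1 - n%:R `^ (- t)).
  elim: n => // -[|n] IH _.
    by rewrite big_nat1 !powR1 subrr mulr0 addr0.
  rewrite big_nat_recr//=; have := IH isT; have := step n.+1 isT.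
  rewrite !mulrBr; lra.
case=> [|[|n]].
- by rewrite big_geq// addr_ge0// invr_ge0 ltW.
- by rewrite big_geq// addr_ge0// invr_ge0 ltW.
apply: le_trans (main n.+1 isT) _.
by rewrite lerD2l ler_piMr ?invr_ge0 ?ltW// gerBl powR_ge0.
Qed.

(** From [expR (x / n) >= x / n] comes [expR (- x) <= (n / x) ^ n]. With [x = c * k ^ beta] and [n]
    chosen so that [n * beta >= 3], the factor [k] still leaves a decay of [k ^ -2]. *)
Lemma sum_expR_powR_bounded (R : realType) (c beta : R) : 0 < c -> 0 < beta ->
  exists2 T : R, 0 <= T &
    forall n, \sum_(1 <= k < n) k%:R * expR (- (c * k%:R `^ beta)) <= T.
Proof.
move=> c0 beta0.
have [M M0 HM] := @sum_powRN_bounded R 2 ltac:(lra).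
pose n := (Num.truncn (3 / beta)).+1.
have n0 : 0 < n%:R :> R by rewrite ltr0n.
have nb : 3 <= n%:R * beta.
  by rewrite -ler_pdivrMr// ltW// truncnS_gt.
have D0 : 0 <= (n%:R / c) ^+ n by rewrite exprn_ge0// divr_ge0// ltW.
exists ((n%:R / c) ^+ n * M) => [|N]; first exact: mulr_ge0.
apply: le_trans (ler_wpM2l D0 (HM N)).
rewrite mulr_sumr ler_sum_nat// => k /andP[k1 _].
have kR : 0 < k%:R :> R by rewrite ltr0n.
have kb : 0 < k%:R `^ beta by rewrite powR_gt0.
have e1 : expR (- (c * k%:R `^ beta)) <= (n%:R / c) ^+ n * k%:R `^ (- (n%:R * beta)).
  set x := c * _; have x0 : 0 < x by rewrite mulr_gt0.
  have -> : (n%:R / c) ^+ n * k%:R `^ (- (n%:R * beta)) = (x / n%:R) ^- n.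
    rewrite powRN mulrC [n%:R * beta]mulrC powRrM powR_mulrn ?powR_ge0//.
    rewrite -exprVn -exprMn -exprVn; congr (_ ^+ n).
    by rewrite /x; field; rewrite !gt_eqF.
  rewrite expRN lef_pV2 ?posrE ?expR_gt0 ?exprn_gt0 ?divr_gt0//.
  have -> : expR x = expR (x / n%:R) ^+ n.
    by rewrite -expRM_natl mulrC divfK ?gt_eqF.
  rewrite lerXn2r ?nnegrE ?expR_ge0 ?divr_ge0 ?ltW//.
  by apply: lt_le_trans (expR_ge1Dx _); rewrite ltrDr.
apply: le_trans (ler_wpM2l (ltW kR) e1) _.
rewrite mulrCA ler_wpM2l// -[X in X * _ <= _]powRr1 ?(ltW kR)//.
rewrite -powRD ?(gt_eqF kR) ?implybT//.
by rewrite ler_powR ?ler1n//; lra.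
Qed.

(** The strict gap between [mu] and [nu] is what later makes the exponent of the comparison series
    exceed 1. *)
Lemma cvg_lower_bound (R : realType) (u : nat -> R) (A : \bar R) (mu : R) :
  (fun j => (u j)%:E) @ \oo --> A -> (mu%:E < A)%E ->
  exists2 nu : R, mu < nu & exists J, forall j, (J <= j)%N -> nu <= u j.
Proof.
move=> uA muA.
have [nu munu nuA] : exists2 nu : R, mu < nu & (nu%:E < A)%E.
  case: A muA {uA} => [r| |]//; last by exists (mu + 1); rewrite ?ltry// ltrDl.
  by rewrite lte_fin => mur; exists ((mu + r) / 2); rewrite ?lte_fin; lra.
exists nu => //.
have : nbhs A [set y | (nu%:E < y)%E].
  exact: (open_nbhs_nbhs (conj (@open_ereal_gt_ereal R nu%:E) nuA)).
move=> /uA [J _ HJ]; exists J => j Jj.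
by have := HJ j Jj; rewrite /= lte_fin => /ltW.
Qed.

Lemma powR_expRN_lnV (R : realType) (omega x : R) : 0 < omega ->
  omega `^ x = expR (- (x * ln omega^-1)).
Proof. by move=> o0; rewrite powR_expR// lnV ?posrE// mulrN opprK. Qed.

Lemma lnV_gt0 (R : realType) (omega : R) : 0 < omega < 1 -> 0 < ln omega^-1.
Proof. by move=> /andP[omega0 omega1]; rewrite ln_gt0// invf_gt1. Qed.

Lemma sum_weights_bounded (R : realType) (a : nat -> R) (omega lambda : R)
    (A : \bar R) :
  (forall j, (1 <= j)%N -> 0 < a j) -> 0 < omega < 1 -> 0 < lambda ->
  (fun j => (a j / ln j%:R)%:E) @ \oo --> A ->
  ((lambda * ln omega^-1)^-1%:E < A)%E ->
  exists2 M : R, 0 <= M &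
    forall n, \sum_(1 <= j < n) omega `^ (lambda * a j) <= M.
Proof.
move=> a0 o01 l0 acvg muA.
have L0 := lnV_gt0 o01; have o0 : 0 < omega by case/andP: o01.
have lL0 : 0 < lambda * ln omega^-1 by exact: mulr_gt0.
have [nu munu [J HJ]] := cvg_lower_bound acvg muA.
pose s := lambda * ln omega^-1 * nu.
have s1 : 1 < s by rewrite /s mulrC -ltr_pdivrMr// mul1r.
have [M M0 HM] := sum_powRN_bounded s1.
(* The first [J.+2] terms are at most 1 each. The cutoff is [J.+2] instead of [J] so that [j >= 2],
   hence [ln j > 0], beyond it. *)
exists (J.+2%:R + M) => [|n]; first by rewrite addr_ge0.
apply: (@le_trans _ _ (\sum_(1 <= j < n)
    ((j < J.+2)%N%:R + j%:R `^ (- s)))).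
  rewrite ler_sum_nat// => j /andP[j1 _].
  have jR : 0 < j%:R :> R by rewrite ltr0n.
  case: ltnP => [jJ|jJ].
    rewrite -[leLHS]addr0 lerD ?powR_ge0//.
    rewrite powR_expRN_lnV// -[leRHS]expR0 ler_expR oppr_le0.
    by rewrite !mulr_ge0// ltW// a0.
  rewrite add0r powR_expRN_lnV// powR_expR// ler_expR mulNr lerN2.
  have lnj : 0 < ln j%:R :> R by rewrite ln_gt0// ltr1n (leq_trans _ jJ).
  rewrite /s mulrAC -mulrA [leRHS]mulrAC ler_pM2l//.
  by rewrite mulrC -ler_pdivlMr// HJ// (leq_trans _ jJ)// -addn2 leq_addr.
rewrite big_split/= lerD//.
rewrite -natr_sum ler_nat big_mkcond/=.
apply: (@leq_trans (\sum_(0 <= j < n) (j < J.+2)%N)).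
  case: n => [|n]; first by rewrite big_geq.
  by rewrite [leqRHS]big_ltn// leq_addl.
have key m : (\sum_(0 <= j < m) (j < J.+2) = minn m J.+2)%N.
  elim: m => [|m IHm]; first by rewrite big_geq// min0n.
  by rewrite big_nat_recr//= IHm; case: ltnP; lia.
by rewrite key geq_minr.
Qed.

(** * Sums over one coordinate and their product *)

(** As [Negz k] is [-(k+1)], this enumerates the integers from [-K] to [K-1] once each, by a finite
    type over which a product of sums can be expanded. *)
Definition signed_ord (K : nat) (x : 'I_K + 'I_K) : int :=
  match x with inl k => Posz k | inr k => Negz k end.

(* The factor [maxn 1 `|m|] bounds, up to 1/N, the proportion of generating
   vectors z with N | h.z when m is a nonzero coordinate of h. *)
Definition coord_weight (R : realType) (omega lambda a b : R) (m : int) : R :=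
  (maxn 1 `|m|)%:R * omega `^ (lambda * (a * `|m%:~R| `^ b)).

Lemma coord_weight_ge0 (R : realType) (omega lambda a b : R) (m : int) :
  0 <= coord_weight omega lambda a b m.
Proof. by rewrite mulr_ge0 ?powR_ge0. Qed.

(** The 1 comes from [m = 0]. All other terms must keep the factor [omega ^ (lambda * a j)], whose
    summability over [j] controls the product over the coordinates. *)
Lemma sum_coord_weight_bounded (R : realType) (a b : nat -> R)
    (omega lambda : R) :
  (forall j, (1 <= j)%N -> 0 < a j) ->
  (forall i j, (1 <= i)%N -> (i <= j)%N -> a i <= a j) ->
  (forall j, (1 <= j)%N -> 0 < b j) ->
  0 < inf [set b j | j in [set j | (1 <= j)%N]] ->
  0 < omega < 1 -> 0 < lambda ->
  exists2 T : R, 0 <= T & forall j K, (1 <= j)%N ->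
    \sum_(x : 'I_K + 'I_K) coord_weight omega lambda (a j) (b j) (signed_ord x)
      <= 1 + T * omega `^ (lambda * a j).
Proof.
move=> a0 amono b0 binf o01 l0.
have L0 := lnV_gt0 o01; have o0 : 0 < omega by case/andP: o01.
set beta := inf _ in binf.
have bbeta j : (1 <= j)%N -> beta <= b j.
  move=> j1; apply: ge_inf; last by exists j.
  by exists 0 => _ [i /= i1 <-]; rewrite ltW// b0.
pose c := lambda * a 1 * ln omega^-1.
have c0 : 0 < c by rewrite !mulr_gt0// a0.
have [T T0 HT] := sum_expR_powR_bounded c0 binf.
pose E := expR c * T.
have E0 : 0 <= E by rewrite mulr_ge0// expR_ge0.
exists (E + E) => [|j K j1]; first exact: addr_ge0.
set F := coord_weight _ _ _ _; set W := omega `^ _.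
have termb k : (0 < k)%N ->
    k%:R * omega `^ (lambda * (a j * k%:R `^ b j)) <=
    W * expR c * (k%:R * expR (- (c * k%:R `^ beta))).
  move=> k0; have kR : 0 < k%:R :> R by rewrite ltr0n.
  rewrite [leRHS]mulrCA ler_pM2l// /W !(powR_expRN_lnV _ o0) -!expRD ler_expR.
  have kb : k%:R `^ beta <= k%:R `^ b j by rewrite ler_powR ?ler1n ?bbeta.
  have k1 : 1 <= k%:R `^ beta.
    by rewrite -[X in X <= _](powRr0 k%:R) ler_powR ?ler1n// ltW.
  have h1 : a j * k%:R `^ beta <= a j * k%:R `^ b j.
    by rewrite ler_pM2l// a0.
  (* Expanding this product splits the exponent into [a j], which gives [W], and
     [a 1 * (k ^ beta - 1)], which gives a series independent of [j]. *)
  have h2 : 0 <= (a j - a 1) * (k%:R `^ beta - 1).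
    by rewrite mulr_ge0// subr_ge0// amono.
  have h3 : a j + a 1 * k%:R `^ beta - a 1 <= a j * k%:R `^ b j by nra.
  have h4 : 0 < lambda * ln omega^-1 by rewrite mulr_gt0.
  have := ler_wpM2l (ltW h4) h3; rewrite /c; nra.
have sumb n : \sum_(1 <= k < n) k%:R * omega `^ (lambda * (a j * k%:R `^ b j))
    <= E * W.
  rewrite /E mulrAC [expR c * W]mulrC.
  apply: le_trans (ler_wpM2l _ (HT n)); last by rewrite mulr_ge0 ?powR_ge0 ?expR_ge0.
  by rewrite mulr_sumr ler_sum_nat// => k /andP[k1 _]; exact: termb.
have Fk (m : int) : m != 0 ->
    F m = `|m|%N%:R * omega `^ (lambda * (a j * `|m|%N%:R `^ b j)).
  move=> m0; rewrite /F /coord_weight (maxn_idPr _) ?absz_gt0//.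
  by rewrite -intr_norm natr_absz.
rewrite big_sumType/=.
rewrite mulrDl addrA lerD//.
  case: K => [|K]; first by rewrite big_ord0 addr_ge0// mulr_ge0// powR_ge0.
  rewrite big_ord_recl lerD//.
    (* Positivity of [b j] matters at [m = 0], since [powR] gives 1 to the power 0 of 0. *)
    rewrite /F /coord_weight/= normr0 powR0 ?gt_eqF ?b0//.
    by rewrite !mulr0 powRr0 mulr1 maxnE.
  apply: le_trans (sumb K.+1); rewrite big_add1 big_mkord.
  by rewrite ler_sum// => k _; rewrite Fk.
apply: le_trans (sumb K.+1); rewrite big_add1 big_mkord.
by rewrite ler_sum// => k _; rewrite Fk.
Qed.

(** The inequality [1 + x <= expR x] reduces the product to the exponential of a bounded sum. *)
Lemma prod_coord_weight_bounded (R : realType) (a b : nat -> R)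
    (omega lambda : R) (A : \bar R) :
  (forall j, (1 <= j)%N -> 0 < a j) ->
  (forall i j, (1 <= i)%N -> (i <= j)%N -> a i <= a j) ->
  (forall j, (1 <= j)%N -> 0 < b j) ->
  0 < inf [set b j | j in [set j | (1 <= j)%N]] ->
  0 < omega < 1 -> 0 < lambda ->
  (fun j => (a j / ln j%:R)%:E) @ \oo --> A ->
  ((lambda * ln omega^-1)^-1%:E < A)%E ->
  exists2 M : R, 0 < M & forall d K,
    \prod_(i < d) \sum_(x : 'I_K + 'I_K)
      coord_weight omega lambda (a i.+1) (b i.+1) (signed_ord x) <= M.
Proof.
move=> a0 amono b0 binf o01 l0 acvg muA.
have [T T0 HT] := @sum_coord_weight_bounded R a b omega lambda a0 amono b0 binf o01 l0.
have [M M0 HM] := sum_weights_bounded a0 o01 l0 acvg muA.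
exists (expR (T * M)) => [|d K]; first exact: expR_gt0.
apply: (@le_trans _ _ (\prod_(i < d) expR (T * omega `^ (lambda * a i.+1)))).
  apply: ler_prod => i _; apply/andP; split.
    by rewrite sumr_ge0// => x _; exact: coord_weight_ge0.
  exact: le_trans (HT _ _ _) (expR_ge1Dx _).
rewrite -expR_sum ler_expR -mulr_sumr ler_wpM2l//.
by have := HM d.+1; rewrite big_add1 big_mkord.
Qed.

(** * Counting generating vectors *)

(** For two solutions, [|m| * c] and [|m| * c'] have the same remainder modulo [N]. So a solution is
    determined by the quotient of [|m| * c] by [N], which takes fewer than [|m| + 1] values. *)
Lemma card_linear_congruence (N : nat) (m r : int) : m != 0 ->
  (#|[pred c : 'I_N | (N %| (m * c%:Z + r)%R)%Z]| <= `|m|)%N.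
Proof.
move=> m0; have am0 : (0 < `|m|)%N by rewrite absz_gt0.
have qP (c : 'I_N) : ((`|m| * c) %/ N < `|m|)%N.
  by rewrite ltn_divLR ?ltn_pmul2l ?(leq_ltn_trans _ (ltn_ord c)).
rewrite -[leqRHS]card_ord; pose q c := Ordinal (qP c).
apply: (leq_card_in q) => c c'; rewrite !inE => Nc Nc' /(congr1 val)/= qq.
apply/val_inj/eqP; rewrite -(eqn_pmul2l am0).
rewrite (divn_eq (`|m| * c) N) (divn_eq (`|m| * c') N) qq eqn_add2l.
have : (N %| m * (c%:Z - c'%:Z))%Z.
  rewrite (_ : m * _ = (m * c%:Z + r) - (m * c'%:Z + r)); last by ring.
  by rewrite rpredB.
rewrite -(rpredMsign _ (m < 0)%R) mulrA -abszEsign mulrBr -!PoszM -eqz_mod_dvd.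
by rewrite !modz_nat.
Qed.

Definition update_coord (N d : nat) (z : {ffun 'I_d -> 'I_N}) (j : 'I_d)
    (c : 'I_N) : {ffun 'I_d -> 'I_N} :=
  [ffun i => if i == j then c else z i].

(* Exchanging the old and the new value of the coordinate is an involution on
   the pairs (z, c). *)
Lemma sum_update_coord (N d : nat) (j : 'I_d) (F : {ffun 'I_d -> 'I_N} -> nat) :
  (\sum_z \sum_(c < N) F (update_coord z j c) = N * \sum_z F z)%N.
Proof.
pose phi (p : {ffun 'I_d -> 'I_N} * 'I_N) := (update_coord p.1 j p.2, p.1 j).
have phiK : involutive phi.
  case=> z c; rewrite /phi/= ffunE eqxx; congr (_, _).
  by apply/ffunP => i; rewrite !ffunE; case: eqP => // ->.
rewrite pair_big/= (reindex_inj (inv_inj phiK))/=.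
rewrite (eq_bigr (fun p => F p.1)) => [|[z c] _]; last first.
  by congr F; have := phiK (z, c) => -[].
rewrite -(pair_big xpredT xpredT (fun z _ => F z))/= big_distrr/=.
by apply: eq_bigr => z _; rewrite sum_nat_const card_ord.
Qed.

(* The first coordinate of the generating vector is 1, so that the N points of
   the lattice rule are distinct. *)
Definition generator (N d : nat) (z : {ffun 'I_d -> 'I_N}) (i : 'I_d) : nat :=
  if val i == 0%N then 1%N else z i.

Definition in_dual_lattice (N d : nat) (z : {ffun 'I_d -> 'I_N})
    (h : d.-tuple int) : bool :=
  (N %| \sum_(i < d) tnth h i * (generator z i)%:Z)%Z.

Lemma card_in_dual_lattice (N d : nat) (h : d.-tuple int) :
  (exists j, tnth h j != 0) ->
  (N * #|[pred z : {ffun 'I_d -> 'I_N} | in_dual_lattice z h]| <=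
   (\prod_(i < d) maxn 1 `|tnth h i|) * N ^ d)%N.
Proof.
move=> [j0 hj0].
have le_prod j : (`|tnth h j| <= \prod_(i < d) maxn 1 `|tnth h i|)%N.
  rewrite (bigD1 j)//=; apply: leq_trans (leq_maxr 1 _) _.
  by rewrite leq_pmulr// prodn_gt0// => i; rewrite leq_max.
have cardN : #|{: {ffun 'I_d -> 'I_N}}| = (N ^ d)%N.
  by rewrite card_ffun !card_ord.
case: (pickP [pred j : 'I_d | (val j != 0%N) && (tnth h j != 0)]) => [j|none].
  move=> /andP[/negPf j1 hj].
  (* The factor [N] is absorbed by redrawing coordinate [j]; for each [z] at most [|h_j|] of the new
     values are solutions. *)
  rewrite -sum1_card big_mkcond/= -(sum_update_coord j) -cardN mulnC -sum_nat_const.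
  apply: leq_sum => z _; apply: leq_trans (le_prod j).
  rewrite -big_mkcond sum1_card.
  pose r := \sum_(i < d | i != j) tnth h i * (generator z i)%:Z.
  have e c : in_dual_lattice (update_coord z j c) h =
      (N %| tnth h j * c%:Z + r)%Z.
    rewrite /in_dual_lattice (bigD1 j)//= /generator j1 ffunE eqxx.
    congr (_ %| _ + _)%Z; apply: eq_bigr => i /negPf ij.
    by rewrite ffunE ij.
  apply: leq_trans (card_linear_congruence N r hj).
  apply: subset_leq_card; apply/fintype.subsetP => c zc.
  by rewrite inE -e; exact: zc.
have h0 i : val i != 0%N -> tnth h i = 0.
  by move=> i0; have := none i; rewrite /= i0/= => /negbT; rewrite negbK => /eqP.
have j00 : val j0 = 0%N.
  by apply/eqP/negPn/negP => /h0 /eqP; rewrite (negPf hj0).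
(* Only the first coordinate of [h] is nonzero and its generator is 1, so membership means that [N]
   divides it, whatever [z] is. Then [N <= |h_0|], or else the count is 0. *)
have [|nN] := boolP [exists z : {ffun 'I_d -> 'I_N}, in_dual_lattice z h].
  move=> /existsP[z]; rewrite /in_dual_lattice (bigD1 j0)//= big1 => [|i ij].
    rewrite /generator j00 eqxx addr0 mulr1 => NN.
    rewrite leq_mul//; last by rewrite -cardN max_card.
    apply: leq_trans (le_prod j0); rewrite dvdn_leq ?absz_gt0//.
  rewrite h0 ?mul0r//; apply: contra ij => /eqP i0.
  by apply/eqP/val_inj; rewrite /= i0.
rewrite eq_card0 ?muln0// => z; rewrite !inE; apply/negbTE.
by apply: contra nN => ?; apply/existsP; exists z.
Qed.

(** * Averaging over the generating vectors *)

Lemma ler_sum_uniq_sub (R : numDomainType) (T : eqType) (s1 s2 : seq T)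
    (F : T -> R) : uniq s1 -> uniq s2 -> {subset s1 <= s2} ->
  (forall x, 0 <= F x) -> \sum_(x <- s1) F x <= \sum_(x <- s2) F x.
Proof.
move=> u1 u2 s12 F0.
rewrite [leRHS](bigID (mem s1))/= -[leLHS]addr0 lerD ?sumr_ge0//.
rewrite -[leRHS]big_filter (perm_big [seq x <- s2 | x \in s1])//.
apply: uniq_perm => //; first exact: filter_uniq.
by move=> x; rewrite mem_filter andb_idr// => /s12.
Qed.

(** Each single term satisfies [r x <= S], hence [r x <= r x ^ lambda * S ^ (1 - lambda)]; then
    sum. *)
Lemma sum_le_of_sum_powR (R : realType) (T : eqType) (s : seq T) (r : T -> R)
    (lambda S : R) : 0 < lambda <= 1 -> 0 < S -> (forall x, 0 <= r x) ->
  \sum_(x <- s) r x `^ lambda <= S `^ lambda -> \sum_(x <- s) r x <= S.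
Proof.
move=> /andP[l0 l1] S0 r0 rS.
have rxS x : x \in s -> r x <= S.
  move=> xs; have : r x `^ lambda <= S `^ lambda.
    apply: le_trans rS; rewrite (big_rem x)//= lerDl sumr_ge0// => y _.
    exact: powR_ge0.
  move=> h; rewrite leNgt; apply/negP => Sr.
  have := gt0_ltr_powR l0 _ _ Sr.
  by rewrite !nnegrE r0 (ltW S0) ltNge h => /(_ isT isT).
apply: (@le_trans _ _ (\sum_(x <- s) r x `^ lambda * S `^ (1 - lambda))).
  rewrite big_seq [leRHS]big_seq ler_sum// => x xs.
  have [rx|rx] := eqVneq (r x) 0.
    by rewrite rx mulr_ge0// powR_ge0.
  rewrite -[leLHS]powRr1// -[in leLHS](subrKC lambda 1) powRD ?rx ?implybT//.
  rewrite ler_wpM2l ?powR_ge0// ge0_ler_powR ?nnegrE ?subr_ge0 ?(ltW S0)//.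
  exact: rxS.
rewrite -mulr_suml; apply: le_trans (ler_wpM2r (powR_ge0 _ _) rS) _.
by rewrite -powRD ?(gt_eqF S0) ?implybT// subrKC powRr1// ltW.
Qed.

Lemma signed_ord_inj (K : nat) : injective (@signed_ord K).
Proof. by move=> [x|x] [y|y] //= [] /val_inj ->. Qed.

Lemma signed_ord_onto (K : nat) (m : int) : (`|m| < K)%N ->
  exists x : 'I_K + 'I_K, signed_ord x = m.
Proof.
case: m => [k|k] /= kK; first by exists (inl (Ordinal kK)).
by exists (inr (Ordinal (ltnW kK))).
Qed.

(** The finite set [B] lies in a box, and expanding the right-hand side gives the nonnegative sum
    over the whole box. *)
Lemma sum_prod_le_prod_sum (R : realType) (d : nat) (cw : 'I_d -> int -> R)
    (B : {fset d.-tuple int}) : (forall i m, 0 <= cw i m) ->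
  exists K, \sum_(h <- B) \prod_(i < d) cw i (tnth h i) <=
    \prod_(i < d) \sum_(x : 'I_K + 'I_K) cw i (signed_ord x).
Proof.
move=> cw0; pose K := (\max_(h <- B) \max_(i < d) `|tnth h i|).+1.
exists K; rewrite bigA_distr_bigA/=.
pose t (f : {ffun 'I_d -> 'I_K + 'I_K}) : d.-tuple int :=
  [tuple signed_ord (f i) | i < d].
have tinj : injective t.
  move=> f g fg; apply/ffunP => i; apply: signed_ord_inj.
  by have /(congr1 (fun h => tnth h i)) := fg; rewrite !tnth_mktuple.
rewrite [leRHS](eq_bigr (fun f => \prod_i cw i (tnth (t f) i))); last first.
  by move=> f _; apply: eq_bigr => i _; rewrite tnth_mktuple.
rewrite [leRHS](_ : _ = \sum_(h <- map t (enum {ffun 'I_d -> 'I_K + 'I_K}))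
    \prod_i cw i (tnth h i)); last by rewrite big_map big_enum.
apply: ler_sum_uniq_sub => [||h hB|h].
- exact: fset_uniq.
- by rewrite map_inj_uniq// enum_uniq.
- have hK i : exists x : 'I_K + 'I_K, signed_ord x = tnth h i.
    apply: signed_ord_onto; rewrite ltnS.
    apply: leq_trans (leq_bigmax_seq _ hB isT).
    exact: (leq_bigmax i).
  have /boolp.choice [g gP] := hK.
  apply/mapP; exists [ffun i => g i]; first by rewrite mem_enum.
  by apply: eq_from_tnth => i; rewrite tnth_mktuple ffunE gP.
- exact: prodr_ge0.
Qed.

Lemma powR_weight_exponent (R : realType) (a b : nat -> R)
    (omega lambda : R) (d : nat) (h : d.-tuple int) : 0 < omega ->
  (\prod_(i < d) maxn 1 `|tnth h i|)%N%:R *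
    omega `^ (lambda * weight_exponent a b h) =
  \prod_(i < d) coord_weight omega lambda (a i.+1) (b i.+1) (tnth h i).
Proof.
move=> o0; rewrite /coord_weight big_split/= natr_prod; congr (_ * _).
rewrite (powR_expR _ o0) mulr_sumr mulr_suml expR_sum.
by apply: eq_bigr => i _; rewrite (powR_expR _ o0).
Qed.

(** One [z] has to serve all finite [B]. If every [z] failed for some [Bz z], all would fail for the
    union of these finitely many sets, against the average over [z]. *)
Lemma exists_good_generator (R : realType) (a b : nat -> R)
    (omega lambda M : R) (d N : nat) : 0 < omega -> (0 < N)%N ->
  (forall K, \prod_(i < d) \sum_(x : 'I_K + 'I_K)
      coord_weight omega lambda (a i.+1) (b i.+1) (signed_ord x) <= M) ->
  exists z : {ffun 'I_d -> 'I_N}, forall B : {fset d.-tuple int},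
    (forall h, h \in B -> exists j, tnth h j != 0) ->
    \sum_(h <- B | in_dual_lattice z h)
      omega `^ (lambda * weight_exponent a b h) <= M / N%:R.
Proof.
move=> o0 N0 HM; apply/not_existsP => bad.
pose r (h : d.-tuple int) := omega `^ (lambda * weight_exponent a b h).
have r0 h : 0 <= r h by exact: powR_ge0.
have /boolp.choice [Bz HB] : forall z : {ffun 'I_d -> 'I_N},
    exists B : {fset d.-tuple int},
    (forall h, h \in B -> exists j, tnth h j != 0) /\
    M / N%:R < \sum_(h <- B | in_dual_lattice z h) r h.
  move=> z; have /existsNP[B /not_implyP[B0 /negP]] := bad z.
  by rewrite -ltNge => ?; exists B.
pose B := (\bigcup_(z <- enum {ffun 'I_d -> 'I_N}) Bz z)%fset.
have Bn0 h : h \in B -> exists j, tnth h j != 0.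
  by move=> /bigfcupP[z _ hz]; exact: (HB z).1 hz.
have BzB (z : {ffun 'I_d -> 'I_N}) : M / N%:R < \sum_(h <- B | in_dual_lattice z h) r h.
  have [_ Bz_gt] := HB z; apply: (lt_le_trans Bz_gt).
  rewrite big_mkcond [leRHS]big_mkcond/=.
  apply: ler_sum_uniq_sub => [||h hz|h]; [exact: fset_uniq..| |by case: ifP].
  by apply/bigfcupP; exists z => //; rewrite mem_enum.
have NR : 0 < N%:R :> R by rewrite ltr0n.
have [K HK] := @sum_prod_le_prod_sum R d
  (fun i m => coord_weight omega lambda (a i.+1) (b i.+1) m) B
  (fun i m => coord_weight_ge0 _ _ _ _ _).
(* Summing over [z] first replaces the dual-lattice condition by the count of
   [card_in_dual_lattice]. *)
have up : N%:R * \sum_(z : {ffun 'I_d -> 'I_N}) \sum_(h <- B | in_dual_lattice z h) r h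
    <= M * (N ^ d)%N%:R.
  apply: (@le_trans _ _ ((\sum_(h <- B) \prod_(i < d)
     coord_weight omega lambda (a i.+1) (b i.+1) (tnth h i)) * (N ^ d)%N%:R)).
    under eq_bigr do rewrite big_mkcond.
    rewrite exchange_big/= mulr_sumr mulr_suml big_seq [leRHS]big_seq.
    apply: ler_sum => h hB; rewrite -powR_weight_exponent// -/(r h).
    rewrite -big_mkcond sumr_const -[r h *+ _]mulr_natl mulrA [leRHS]mulrAC.
    by rewrite ler_wpM2r// -!natrM ler_nat card_in_dual_lattice//; exact: Bn0.
  by rewrite ler_wpM2r// (le_trans HK).
have : N%:R * \sum_(z : {ffun 'I_d -> 'I_N}) (M / N%:R) <
    N%:R * \sum_(z : {ffun 'I_d -> 'I_N}) \sum_(h <- B | in_dual_lattice z h) r h.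
  rewrite ltr_pM2l//; apply: ltr_sum => //.
  by apply/hasP; exists [ffun=> Ordinal N0] => //; exact: mem_index_enum.
move=> /lt_le_trans /(_ up); rewrite sumr_const card_ffun !card_ord.
by rewrite -[(M / _) *+ _]mulr_natr mulrA [_ * (M / _)]mulrC divfK ?gt_eqF// ltxx.
Qed.

(** * Complex modulus and exponentials *)

(** The norm of [R[i]] is valued in [R[i]]; this identity transfers its properties to the
    real-valued [cabs]. *)
Lemma normr_cabs (R : realType) (z : R[i]) : `|z| = ((cabs z)%:C)%C.
Proof. by []. Qed.

Lemma cabsD (R : realType) (x y : R[i]) : cabs (x + y) <= cabs x + cabs y.
Proof. by rewrite -lecR rmorphD/= -!normr_cabs ler_normD. Qed.

Lemma cabs_sum (R : realType) (I : Type) (s : seq I) (P : pred I) (F : I -> R[i]) :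
  cabs (\sum_(i <- s | P i) F i) <= \sum_(i <- s | P i) cabs (F i).
Proof. by rewrite -lecR rmorph_sum/= -normr_cabs ler_norm_sum. Qed.

Lemma cabsN (R : realType) (x : R[i]) : cabs (- x) = cabs x.
Proof. by apply: (@complexI R); rewrite -!normr_cabs normrN. Qed.

Lemma cabsM (R : realType) (x y : R[i]) : cabs (x * y) = cabs x * cabs y.
Proof. exact: ComplexField.Normc.normcM. Qed.

Lemma cabs_natV (R : realType) (n : nat) : cabs (n%:R^-1 : R[i]) = n%:R^-1.
Proof.
by apply: (@complexI R); rewrite -normr_cabs normfV normr_nat fmorphV rmorph_nat.
Qed.

Lemma expiD (R : realType) (x y : R) : expi (x + y) = expi x * expi y.
Proof.
rewrite /expi cosD sinD [sin x * _ + _]addrC; apply/eqP.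
by rewrite eq_complex/= !eqxx.
Qed.

Lemma expi0 (R : realType) : expi 0 = 1 :> R[i].
Proof. by rewrite /expi cos0 sin0. Qed.

Lemma expi_2pi (R : realType) : expi (2 * pi) = 1 :> R[i].
Proof. by rewrite /expi mulr_natl cos2pi sin2pi. Qed.

Lemma expi_nat (R : realType) (x : R) (n : nat) : expi (x * n%:R) = expi x ^+ n.
Proof.
elim: n => [|n IH]; first by rewrite mulr0 expi0.
by rewrite -natr1 mulrDr mulr1 expiD IH exprSr.
Qed.

Lemma expi_2pi_int (R : realType) (m : int) : expi (2 * pi * m%:~R) = 1 :> R[i].
Proof.
case: m => n; first by rewrite expi_nat expi_2pi expr1n.
have h : expi (2 * pi * n.+1%:R) = 1 :> R[i] by rewrite expi_nat expi_2pi expr1n.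
have := expiD (2 * pi * n.+1%:R : R) (2 * pi * (Negz n)%:~R).
by rewrite h mul1r => <-; rewrite NegzE mulrNz mulrN subrr expi0.
Qed.

(* The remainder of m mod N is in [0, N), and cos (2 y) = 1 - 2 sin^2 y with
   sin y > 0 for 0 < y < pi. *)
Lemma expi_2pi_div_eq1 (R : realType) (m : int) (N : nat) : (0 < N)%N ->
  expi (2 * pi * (m%:~R / N%:R)) = 1 :> R[i] -> (N %| m)%Z.
Proof.
move=> N0; have NR : 0 < N%:R :> R by rewrite ltr0n.
have N0z : N%:Z != 0 by rewrite eqz_nat -lt0n.
rewrite {1}(divz_eq m N) intrD intrM [(_ + _) / _]mulrDl mulfK ?gt_eqF// mulrDr expiD.
rewrite expi_2pi_int mul1r => e1.
have r0 : (0 <= (m %% N)%Z) by exact: modz_ge0.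
have rN : ((m %% N)%Z < N) by exact: ltz_pmod.
apply/dvdz_mod0P/eqP; case: ltgtP r0 => // r0 _; exfalso.
set y : R := pi * ((m %% N)%Z%:~R / N%:R).
have y0 : 0 < sin y.
  apply: sin_gt0_pi; rewrite mulr_gt0 ?pi_gt0 ?divr_gt0 ?ltr0z//=.
  rewrite -[ltRHS]mulr1 ltr_pM2l ?pi_gt0// ltr_pdivrMr// mul1r.
  by rewrite -[N%:R]/(N%:Z%:~R) ltr_int.
have : cos (y *+ 2) = 1.
  by have /(congr1 (@complex.Re R))/= := e1; rewrite -mulrA mulr_natl.
by rewrite cos_mulr2n cos2sin2; nra.
Qed.

Lemma cabs_expi (R : realType) (x : R) : cabs (expi x) = 1.
Proof. by rewrite /cabs /expi/= cos2Dsin2 sqrtr1. Qed.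

(** * Lattice points and their character sums *)

Definition lattice_point (R : realType) (N d : nat)
    (z : {ffun 'I_d -> 'I_N}) (k : 'I_N) : pt R d :=
  [tuple (((k * generator z i) %% N)%N%:R / N%:R : measurableTypeR R) | i < d].

Lemma lattice_point_half_open (R : realType) (N d : nat)
    (z : {ffun 'I_d -> 'I_N}) (k : 'I_N) :
  half_open_cube (lattice_point R z k).
Proof.
have N0 : (0 < N)%N by exact: leq_ltn_trans (ltn_ord k).
move=> i; rewrite tnth_mktuple in_itv/= divr_ge0//=.
by rewrite ltr_pdivrMr ?ltr0n// mul1r ltr_nat ltn_mod.
Qed.

Lemma lattice_point_inj (R : realType) (N d : nat)
    (z : {ffun 'I_d -> 'I_N}) :
  (0 < d)%N -> injective (lattice_point R z).
Proof.
move=> d0 k k' /(congr1 (fun x => tnth x (Ordinal d0))).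
have N0 : (0 < N)%N by exact: leq_ltn_trans (ltn_ord k).
rewrite !tnth_mktuple /generator/= !muln1 !modn_small//.
have NR : N%:R^-1 != 0 :> R by rewrite invr_eq0 pnatr_eq0 -lt0n.
by move=> /(mulIf NR)/eqP; rewrite eqr_nat => /eqP/val_inj.
Qed.

Lemma expi_dotZ_lattice_point (R : realType) (N d : nat) (z : {ffun 'I_d -> 'I_N})
    (h : d.-tuple int) (k : 'I_N) :
  expi (2 * pi * dotZ h (lattice_point R z k)) =
  expi (2 * pi *
    ((\sum_(i < d) tnth h i * (generator z i)%:Z)%:~R / N%:R)) ^+ k :> R[i].
Proof.
have N0 : (0 < N)%N by exact: leq_ltn_trans (ltn_ord k).
have NR : N%:R != 0 :> R by rewrite pnatr_eq0 -lt0n.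
set m := \sum_(i < d) _.
(* [q] collects the integer parts removed by the reduction modulo [N]; they only contribute full
   turns. *)
pose q : int := \sum_(i < d) tnth h i * ((k * generator z i) %/ N)%N%:Z.
have -> : dotZ h (lattice_point R z k) = m%:~R / N%:R * k%:R - q%:~R.
  rewrite /dotZ /m /q !rmorph_sum/= !mulr_suml -sumrB.
  apply: eq_bigr => i _; rewrite tnth_mktuple !rmorphM/=.
  have /(congr1 (fun n => n%:R : R)) := divn_eq (k * generator z i) N.
  rewrite natrM natrD natrM -!pmulrn => /esym/(canRL (addKr _)) ->.
  by field.
rewrite mulrBr expiD -mulrN -rmorphN expi_2pi_int mulr1 mulrA.
exact: expi_nat.
Qed.

(** This is a geometric sum whose ratio is an [N]-th root of unity other than 1. *)
Lemma sum_expi_lattice_point (R : realType) (N d : nat) (z : {ffun 'I_d -> 'I_N})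
    (h : d.-tuple int) : (0 < N)%N ->
  ~~ in_dual_lattice z h ->
  \sum_(k < N) expi (2 * pi * dotZ h (lattice_point R z k)) = 0 :> R[i].
Proof.
move=> N0 hN; under eq_bigr do rewrite expi_dotZ_lattice_point.
set m := \sum_(i < d) _ in hN *; set q := expi _.
have q1 : q != 1.
  by apply: contra hN => /eqP; apply: expi_2pi_div_eq1.
have : (q - 1) * \sum_(k < N) q ^+ k = 0.
  rewrite -subrX1 /q -expi_nat -mulrA mulfVK ?pnatr_eq0 -?lt0n//.
  by rewrite expi_2pi_int subrr.
by move=> /eqP; rewrite mulf_eq0 subr_eq0 (negPf q1)/= => /eqP.
Qed.

(** * Worst-case error of a lattice rule *)

Lemma dotZ0 (R : realType) (d : nat) (x : pt R d) :
  dotZ [tuple (0 : int) | i < d] x = 0.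
Proof. by rewrite /dotZ big1// => i _; rewrite tnth_mktuple mul0r. Qed.

Lemma fourier_coef0 (R : realType) (d : nat) (f : pt R d -> R[i]) :
  fourier_coef f [tuple (0 : int) | i < d] = cube_integral f.
Proof.
rewrite /fourier_coef; congr cube_integral; apply/funext => x.
by rewrite dotZ0 mulr0 oppr0 expi0 mulr1.
Qed.

Lemma sum_sqr_fourier_coef_le1 (R : realType) (a b : nat -> R) (omega : R)
    (d : nat) (f : pt R d -> R[i]) (B : {fset d.-tuple int}) :
  (Hnorm a b omega f <= 1)%E ->
  \sum_(h <- B) omega `^ (- weight_exponent a b h) * cabs (fourier_coef f h) ^+ 2
    <= 1.
Proof.
have e1 : sqrte 1%E = 1%E :> \bar R by rewrite /= sqrtr1.
rewrite /Hnorm -{1}e1 lee_sqrt// => H.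
rewrite -lee_fin; apply: le_trans H; rewrite -sumEFin.
rewrite fsbig_seq//=; apply: ereal_sup_ubound; exists [set` B] => //.
Qed.

(* Only the frequencies of the dual lattice survive in the error; the AM-GM
   inequality [fhat <= (eps fhat^2 / r + r / eps) / 2] then plays the role of
   Cauchy-Schwarz. *)
Lemma lattice_rule_error (R : realType) (a b : nat -> R) (omega eps : R)
    (d N : nat) (z : {ffun 'I_d -> 'I_N}) :
  0 < omega -> 0 < eps -> (0 < N)%N ->
  (forall B : {fset d.-tuple int},
    (forall h, h \in B -> exists j, tnth h j != 0) ->
    \sum_(h <- B | in_dual_lattice z h) omega `^ weight_exponent a b h
      <= eps ^+ 2) ->
  (worst_case_error a b omega (@lattice_point R N d z) (fun=> N%:R^-1)%R <= eps%:E)%E.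
Proof.
move=> o0 e0 N0 Hz; apply: ge_ereal_sup => _ [f [[_ fsum _] f1] <-].
(* The extra [e] pays for truncating the Fourier series at the points. *)
rewrite lee_fin; apply/ler_addgt0Pr => e e_gt0.
pose x := @lattice_point R N d z; pose c := fourier_coef f.
have xcube k : cube (x k).
  move=> i; have := @lattice_point_half_open R N d z k i.
  by rewrite !in_itv/= => /andP[-> /ltW].
have /boolp.choice [Bk HBk] := fun k => fsum (x k) (xcube k) e e_gt0.
pose h0 : d.-tuple int := [tuple (0 : int) | i < d].
(* A single truncation, containing the zero frequency, is fine enough at all [N] points. *)
pose B := (h0 |` \bigcup_(k <- enum 'I_N) Bk k)%fset.
pose B' := (B `\ h0)%fset.
have h0B : h0 \in B by rewrite fset1U1.
have B'n0 h : h \in B' -> exists j, tnth h j != 0.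
  rewrite in_fsetD1 => /andP[hh0 _].
  have [[j hj]|none] := pselect (exists j, tnth h j != 0); first by exists j.
  case/negP: hh0; apply/eqP/eq_from_tnth => j; rewrite tnth_mktuple.
  by apply/eqP/negPn/negP => hj; apply: none; exists j.
pose D h : R[i] := N%:R^-1 * \sum_(k < N) expi (2 * pi * dotZ h (x k)).
have NC : N%:R != 0 :> R[i] by rewrite pnatr_eq0 -lt0n.
have NR : N%:R != 0 :> R by rewrite pnatr_eq0 -lt0n.
have D0 : D h0 = 1.
  rewrite /D (eq_bigr (fun=> 1)) => [|k _]; last by rewrite dotZ0 mulr0 expi0.
  by rewrite sumr_const card_ord mulVf.
have D1 h : cabs (D h) <= 1.
  rewrite /D cabsM cabs_natV ler_pdivrMl ?ltr0n// mulr1.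
  apply: le_trans (cabs_sum _ _ _) _.
  by rewrite (eq_bigr (fun=> 1)) ?sumr_const ?card_ord// => k _; rewrite cabs_expi.
have Dz h : ~~ in_dual_lattice z h -> D h = 0.
  by move=> hz; rewrite /D sum_expi_lattice_point// mulr0.
have trunc k : cabs (\sum_(h <- B) c h * expi (2 * pi * dotZ h (x k)) - f (x k)) < e.
  apply: HBk; apply/fsubsetP => h hk; apply/fset1UP; right.
  by apply/bigfcupP; exists k => //; rewrite mem_enum.
(* The zero frequency cancels the exact integral. What remains is the mean truncation error and the
   nonzero frequencies, each weighted by the mean [D h] of its character. *)
have -> : cube_integral f - \sum_(k < N) N%:R^-1 * f (x k) =
    N%:R^-1 * \sum_(k < N)
      (\sum_(h <- B) c h * expi (2 * pi * dotZ h (x k)) - f (x k))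
    - \sum_(h <- B') c h * D h.
  rewrite sumrB exchange_big/= mulrBr.
  have -> : N%:R^-1 * \sum_(h <- B) \sum_(k < N) c h * expi (2 * pi * dotZ h (x k))
      = \sum_(h <- B) c h * D h.
    rewrite mulr_sumr; apply: eq_bigr => h _.
    by rewrite -mulr_sumr mulrCA.
  rewrite (big_fsetD1 h0)//= D0 mulr1 /c fourier_coef0 -mulr_sumr.
  by rewrite -/B' [RHS]addrAC addrK.
apply: le_trans (cabsD _ _) _; rewrite addrC lerD//; last first.
  rewrite cabsM cabs_natV ler_pdivrMl ?ltr0n//.
  apply: le_trans (cabs_sum _ _ _) _.
  rewrite (_ : N%:R * e = \sum_(k < N) e); last by rewrite sumr_const card_ord mulr_natl.
  by apply: ler_sum => k _; exact: ltW.
rewrite cabsN.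
apply: le_trans (cabs_sum _ _ _) _.
pose r (h : d.-tuple int) := omega `^ weight_exponent a b h.
have r0 (h : d.-tuple int) : 0 < r h by exact: powR_gt0.
have term h : cabs (c h * D h) <= 2^-1 *
    (eps * (omega `^ (- weight_exponent a b h) * cabs (c h) ^+ 2) +
     eps^-1 * (if in_dual_lattice z h then r h else 0)).
  have c0 : 0 <= cabs (c h) by exact: sqrtr_ge0.
  rewrite powRN -/(r h).
  case: ifPn => [_|hz]; last first.
    rewrite Dz// mulr0 /cabs ComplexField.Normc.normc0 mulr0 addr0.
    by rewrite !mulr_ge0 ?invr_ge0 ?exprn_ge0// ltW.
  rewrite cabsM; apply: le_trans (ler_wpM2l c0 (D1 h)) _; rewrite mulr1.
  rewrite -subr_ge0 (_ : _ - _ = 2^-1 * (eps * r h)^-1 * (eps * cabs (c h) - r h) ^+ 2).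
    by rewrite mulr_ge0 ?sqr_ge0// mulr_ge0 ?invr_ge0// ltW// mulr_gt0.
  by field; rewrite !gt_eqF.
(* The norm of [f] bounds the first sum by 1 and [Hz] bounds the second by [eps ^ 2], so the total
   is [eps]. *)
apply: (@le_trans _ _ (2^-1 * (eps * 1 + eps^-1 * eps ^+ 2))); last first.
  by rewrite expr2 mulKf ?gt_eqF//; lra.
apply: le_trans (ler_sum _ (fun h _ => term h)) _.
rewrite -mulr_sumr ler_pM2l// big_split/= -!mulr_sumr lerD//.
  by rewrite ler_pM2l//; exact: sum_sqr_fourier_coef_le1.
by rewrite ler_pM2l ?invr_gt0// -big_mkcond Hz.
Qed.

(** * From the error bound to tractability *)

(** As [eps ^ (2 * lambda)] is [(eps ^ 2) ^ lambda], the averaged bound on the sum of [lambda]-th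
    powers yields the bound [eps ^ 2] on the sum itself. *)
Lemma minimal_error_le (R : realType) (a b : nat -> R)
    (omega lambda M eps : R) (d N : nat) : 0 < omega -> 0 < lambda <= 1 ->
  0 < eps -> (0 < N)%N -> (0 < d)%N ->
  (forall K, \prod_(i < d) \sum_(x : 'I_K + 'I_K)
      coord_weight omega lambda (a i.+1) (b i.+1) (signed_ord x) <= M) ->
  M / N%:R <= eps `^ (2 * lambda) ->
  (minimal_error a b omega N d <= eps%:E)%E.
Proof.
move=> o0 l01 e0 N0 d0 HM Meps.
have [z Hz] := exists_good_generator (a := a) (b := b) o0 N0 HM.
apply: (@le_trans _ _ (worst_case_error a b omega (@lattice_point R N d z)
   (fun=> N%:R^-1)%R)).
  apply: ereal_inf_lbound; exists (@lattice_point R N d z), (fun=> N%:R^-1).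
  by split => //; [exact: lattice_point_inj | exact: lattice_point_half_open].
apply: lattice_rule_error => // B Bn0.
rewrite -big_filter; apply: (@sum_le_of_sum_powR _ _ _ _ lambda) => // [|h|].
- exact: exprn_gt0.
- exact: powR_ge0.
rewrite big_filter -[eps ^+ 2]powR_mulrn ?(ltW e0)// -powRrM.
apply: le_trans Meps; apply: le_trans (Hz B Bn0).
by apply: ler_sum => h _; rewrite -powRrM mulrC.
Qed.

Lemma ALG_SPT_exponent_lattice (R : realType) (a b : nat -> R)
    (omega lambda : R) (A : \bar R) :
  (forall j, (1 <= j)%N -> 0 < a j) ->
  (forall i j, (1 <= i)%N -> (i <= j)%N -> a i <= a j) ->
  (forall j, (1 <= j)%N -> 0 < b j) ->
  0 < inf [set b j | j in [set j | (1 <= j)%N]] ->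
  0 < omega < 1 ->
  (fun j => (a j / ln j%:R)%:E) @ \oo --> A ->
  0 < lambda <= 1 -> ((lambda * ln omega^-1)^-1%:E < A)%E ->
  ALG_SPT_exponent a b omega (2 * lambda).
Proof.
move=> a0 amono b0 binf o01 acvg l01 lA.
have l0 : 0 < lambda by case/andP: l01.
have o0 : 0 < omega by case/andP: o01.
have [M M0 HM] := prod_coord_weight_bounded a0 amono b0 binf o01 l0 acvg lA.
split; first by rewrite mulr_ge0// ltW.
exists (M + 1) => [|eps d /andP[eps0 eps1] d1]; first by rewrite addr_gt0.
set E := eps `^ (- (2 * lambda)).
have E1 : 1 <= E.
  by rewrite /E -[leLHS](powRr0 eps) ger_powR ?eps0 ?ltW// oppr_lt0 mulr_gt0.
(* This [N] exceeds [M * E], and rounding up costs at most 1, hence at most [E] because [E >= 1]; so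
   [C = M + 1]. *)
pose N := (Num.truncn (M * E)).+1.
have ME0 : 0 <= M * E by rewrite mulr_ge0 ?powR_ge0// ltW.
have NE : N%:R <= (M + 1) * E.
  rewrite mulrDl mul1r /N -natr1 lerD// truncn_le//.
have MN : M / N%:R <= eps `^ (2 * lambda).
  rewrite ler_pdivrMr ?ltr0n// -ler_pdivrMl ?powR_gt0// mulrC -powRN.
  by rewrite ltW// truncnS_gt.
apply: (@le_trans _ _ N%:R%:E); last by rewrite lee_fin.
apply: ereal_inf_lbound; exists N => //; split => //.
exact: (minimal_error_le o0 l01 eps0 _ d1 (HM d) MN).
Qed.

Unset Implicit Arguments.

(* In the last conclusion the quotient is taken in the extended reals, where
   (+oo)^-1 = 0, so that the bound is 0 when A = +oo. *)
Theorem mainTheorem2 (R : realType) (a b : nat -> R) (omega : R) (A : \bar R)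
  (a_gt0 : forall j, (1 <= j)%N -> 0 < a j)
  (a_nondecreasing : forall i j, (1 <= i)%N -> (i <= j)%N -> a i <= a j)
  (b_gt0 : forall j, (1 <= j)%N -> 0 < b j)
  (b_inf_gt0 : 0 < inf [set b j | j in [set j | (1 <= j)%N]])
  (omega01 : 0 < omega < 1)
  (a_log_cvg : (fun j => (a j / ln j%:R)%:E) @ \oo --> A) :
  (forall lambda : R, 0 < lambda <= 1 ->
     ((lambda * ln omega^-1)^-1%:E < A)%E ->
     ALG_SPT_exponent a b omega (2 * lambda)) /\
  (((ln omega^-1)^-1%:E < A)%E ->
     (optimal_ALG_SPT_exponent a b omega <=
        2%:E / (A * (ln omega^-1)%:E))%E).
Proof.
have SPT lambda : 0 < lambda <= 1 -> ((lambda * ln omega^-1)^-1%:E < A)%E ->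
    ALG_SPT_exponent a b omega (2 * lambda).
  exact: ALG_SPT_exponent_lattice.
split=> // LA; have L0 := lnV_gt0 omega01.
(* Here [l1] is the critical value of [lambda]: [1 / (A * ln omega^-1)] for finite [A] and 0 for
   [A = +oo]. *)
suff H (l1 : R) : 0 <= l1 < 1 -> (2%:E / (A * (ln omega^-1)%:E) = (2 * l1)%:E)%E ->
    (forall lambda, l1 < lambda -> ((lambda * ln omega^-1)^-1%:E < A)%E) ->
    (optimal_ALG_SPT_exponent a b omega <= 2%:E / (A * (ln omega^-1)%:E))%E.
  case: A LA a_log_cvg {SPT} H => [A| |]// LA _ H.
    rewrite lte_fin in LA.
    have A0 : 0 < A by apply: lt_trans LA; rewrite invr_gt0.
    have AL : 0 < A * ln omega^-1 by rewrite mulr_gt0.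
    apply: (H (A * ln omega^-1)^-1).
    - by rewrite invr_ge0 ltW//= invf_lt1// -ltr_pdivrMr// mul1r.
    - by rewrite -EFinM inver gt_eqF.
    - move=> lambda ll; have l0 : 0 < lambda by apply: lt_trans ll; rewrite invr_gt0.
      rewrite lte_fin -[ltRHS]invrK ltf_pV2 ?posrE ?invr_gt0 ?mulr_gt0//.
      by rewrite -ltr_pdivrMr// -invfM.
  apply: (H 0).
  - by rewrite lexx ltr01.
  - by rewrite gt0_mulye ?lte_fin// invey mule0 mulr0.
  - by move=> lambda _; rewrite ltry.
move=> /andP[l10 l11] -> Hl; apply/lee_addgt0Pr => e e0.
(* Capping at 1 keeps [lambda] admissible, and still above [l1] as [l1 < 1]; the half of [e] offsets
   the factor 2 in the exponent. *)
pose lambda := Num.min 1 (l1 + e / 2).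
have ll : l1 < lambda by rewrite lt_min l11/=; lra.
apply: (@le_trans _ _ (2 * lambda)%:E).
  apply: ereal_inf_lbound; exists (2 * lambda) => //; apply: SPT; last exact: Hl.
  by rewrite (le_lt_trans l10 ll) ge_min lexx.
have : lambda <= l1 + e / 2 by rewrite ge_min lexx orbT.
by rewrite -EFinD lee_fin; lra.
Qed.
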